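(* For each $\sigma\ge 1$ and $n\ge 1$, $\mathit{SQ}'_{\mathrm{Abel}}(n,\sigma)\le (n-1)^{11/6}$.
   Context: For a word $w$ over the alphabet $\{0,\ldots,\sigma-1\}$, its Parikh vector is $P(w)=(|w|_0,\ldots,|w|_{\sigma-1})$, where $|w|_c$ counts occurrences of $c$. An Abelian square is a word $uv$ with $u,v$ nonempty, $|u|=|v|$ and $P(u)=P(v)$. Two Abelian squares are equivalent (in the Abelian sense) if they have the same Parikh vector. $\mathit{SQ}'_{\mathrm{Abel}}(n,\sigma)$ is the maximum, over all words $w$ of length $n$ over an alphabet of size $\sigma$, of the number of pairwise nonequivalent Abelian squares occurring as subwords (contiguous factors) of $w$. *)

(* Defs.v *)
From mathcomp Require Import all_boot.

Set Implicit Arguments.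
Unset Strict Implicit.
Unset Printing Implicit Defensive.

Section AbelianSquares.
Variable sigma : nat.
Implicit Types s u v w : seq 'I_sigma.

Definition parikh w : {ffun 'I_sigma -> nat} := [ffun c => count_mem c w].

Definition abelian_square s : bool :=
  [exists k : 'I_(size s).+1,
     let u := take k s in let v := drop k s in
     [&& u != [::], v != [::], size u == size v & parikh u == parikh v]].

Lemma abelian_squareP s :
  reflect (exists u v, [/\ s = u ++ v, u <> [::] /\ v <> [::],
                           size u = size v & parikh u = parikh v])
          (abelian_square s).
Proof.
apply: (iffP existsP) => [[k /and4P[u0 v0 /eqP suv /eqP puv]]|].
  exists (take k s), (drop k s).
  by rewrite cat_take_drop; split=> //; split; apply/eqP.
move=> [u [v [-> [/eqP u0 /eqP v0] suv puv]]].
have ltu : size u < (size (u ++ v)).+1 by rewrite ltnS size_cat leq_addr.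
by exists (Ordinal ltu); rewrite /= take_size_cat // drop_size_cat // u0 v0 suv puv !eqxx.
Qed.

Definition abelian_equiv s u : bool := parikh s == parikh u.

(* Every factor of a word of length n has length at most n, so the factors live
   in the finite type n.-bseq 'I_sigma. *)
Definition abelian_square_factors n (w : n.-tuple 'I_sigma) :
    {set n.-bseq 'I_sigma} :=
  [set s : n.-bseq 'I_sigma | infix s w && abelian_square s].

(* The number of abelian_equiv-classes, i.e. the largest size of a family of
   pairwise nonequivalent Abelian squares occurring in w. *)
Definition num_nonequiv_abelian_squares n (w : n.-tuple 'I_sigma) : nat :=
  #|equivalence_partition (fun s u : n.-bseq 'I_sigma => abelian_equiv s u)
      (abelian_square_factors w)|.

End AbelianSquares.

Definition SQ'_Abel (n sigma : nat) : nat :=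
  \max_(w : n.-tuple 'I_sigma) num_nonequiv_abelian_squares w.

(* Main.v *)
(** Let p_0, ..., p_n be the prefix Parikh vectors of w. An Abelian square
    w[i..i+2k) is a three-term progression p_i, p_(i+k), p_(i+2k), and its class
    is determined by the difference p_(i+2k) - p_i. The first, middle and last
    terms each range over n-1 vectors, so the bound is an instance of the
    Katz-Tao sums-differences inequality: if a, b and a + b take at most N values
    each on a set of pairs (a, b), then a - b takes at most N^(11/6) values.

    For the latter, keep one pair per difference; call the resulting set T, and
    let V be the set of triples (a, b, b') with (a, b) and (a, b') in T, so
    that |T|^2 <= N |V|. Counting the chains v0, v1, v2, v3 in V whose
    consecutive terms agree on (a+b, a+b'), on (b, b') and on (a+b, b')
    respectively gives at least |V|^4 / N^6 of them by convexity, and at most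
    |V| N^2, since such a chain is determined by v0, a2 and b3. Hence
    |V|^3 <= N^8 and |T|^6 <= N^11. *)

Require Import Defs.
From mathcomp Require Import all_boot all_order all_algebra.
From mathcomp Require Import reals exp.
From mathcomp Require Import lra ring zify.

Set Implicit Arguments.
Unset Strict Implicit.
Unset Printing Implicit Defensive.

Import Order.TTheory GRing.Theory Num.Theory.

Local Open Scope ring_scope.

(** * Cauchy-Schwarz and convexity estimates for fibre sizes *)

Section FiberCounting.
Variable R : realFieldType.

(** Cauchy-Schwarz without square roots: sum the tangent bound d >= 2s - s^2/d, with s = k/al the
    value that optimises the sum. *)
Lemma sqr_card_le_sum_mul_sumV (V : finType) (P : pred V) (d : V -> R) :
  (forall x, 0 < d x) ->
  (#|P|%:R) ^+ 2 <= (\sum_(x | P x) d x) * (\sum_(x | P x) (d x)^-1).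
Proof.
move=> d_gt0; set k : R := #|P|%:R; set al := \sum_(x | P x) (d x)^-1.
have [->|[x0 Px0]] : (k = 0) \/ (exists x, P x).
- case: (pickP P) => [x Px|P0]; [by right; exists x | left].
  by rewrite /k (eq_card0 P0).
- rewrite expr0n /= mulr_ge0 ?sumr_ge0 // => x _; first exact: ltW.
  by rewrite invr_ge0 ltW.
have al_gt0 : 0 < al.
  rewrite /al (bigD1 x0) //= ltr_wpDr ?invr_gt0 // sumr_ge0 // => x _.
  by rewrite invr_ge0 ltW.
set s := k / al.
have : \sum_(x | P x) (2 * s - s ^+ 2 * (d x)^-1) <= \sum_(x | P x) d x.
  apply: ler_sum => x _; rewrite -subr_ge0.
  have -> : d x - (2 * s - s ^+ 2 / d x) = (d x - s) ^+ 2 / d x.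
    by field; rewrite gt_eqF.
  by rewrite divr_ge0 ?sqr_ge0 // ltW.
rewrite sumrB sumr_const -[_ *+ #|_|]mulr_natr -/k -mulr_sumr -/al => h.
have -> : k ^+ 2 = (2 * s * k - s ^+ 2 * al) * al.
  by rewrite /s; field; rewrite gt_eqF.
by rewrite ler_pM2r.
Qed.

(** Each nonempty fibre contributes exactly 1 in total. *)
Lemma sum_inv_card_fiber (V Y : finType) (f : V -> Y) :
  \sum_x (#|[pred y | f y == f x]|%:R)^-1 <= #|Y|%:R :> R.
Proof.
rewrite (partition_big f predT) //= -sum1_card natr_sum; apply: ler_sum => y _.
rewrite (eq_bigr (fun=> (#|[pred x | f x == y]|%:R)^-1)); last first.
  by move=> x /eqP <-.
rewrite sumr_const -[X in X <= _]mulr_natl.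
set k := #|_|; have [->|k0] := eqVneq k 0%N; first by rewrite mul0r.
by rewrite divff // pnatr_eq0.
Qed.

(* Tangent plane of the convex function k^4 / (al * be) at (t, 1, 1). *)
Lemma tangent_quartic (S T al be k t : R) :
  0 <= S -> 0 <= T -> 0 <= al -> 0 <= be -> 0 <= k -> 0 <= t ->
  k ^+ 2 <= S * al -> k ^+ 2 <= T * be ->
  4 * t ^+ 3 * k <= S * T + t ^+ 4 * (al + be + 1).
Proof.
move=> S0 T0 al0 be0 k0 t0 hS hT.
have t4 : 0 <= t ^+ 4 by rewrite exprn_ge0.
have [->|kn0] := eqVneq k 0.
  by rewrite mulr0 addr_ge0 ?mulr_ge0 // !addr_ge0.
have k_gt0 : 0 < k by rewrite lt_def kn0.
have k2 : 0 < k ^+ 2 by rewrite exprn_gt0.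
have al_gt0 : 0 < al.
  by rewrite lt_def al0 andbT; apply: contraTneq hS => ->; rewrite mulr0 -ltNge.
(* By AM-GM, al * be <= m^2, so S * T >= q^2 with q = k^2/m. Then (q - t^2)^2 >= 0 and (k - t m)^2
   >= 0 linearise q^2 and q in turn. *)
set m := (al + be) / 2.
have m_gt0 : 0 < m by rewrite divr_gt0 // ltr_wpDr.
have am : al * be <= m ^+ 2.
  by rewrite -subr_ge0 (_ : _ - _ = ((al - be) / 2) ^+ 2) ?sqr_ge0 // /m; field.
set q := k ^+ 2 / m.
have qm : q * m = k ^+ 2 by rewrite /q divfK // gt_eqF.
have hq : q ^+ 2 <= S * T.
  rewrite -(ler_pM2r (exprn_gt0 2 m_gt0)) -exprMn qm.
  apply: le_trans (ler_wpM2l (mulr_ge0 S0 T0) am).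
  by rewrite mulrACA expr2 ler_pM // ltW.
have hqt : 2 * t * k <= q + t ^+ 2 * m.
  rewrite -(ler_pM2r m_gt0) (mulrDl q) qm -subr_ge0.
  by rewrite (_ : _ - _ = (k - t * m) ^+ 2) ?sqr_ge0 //; ring.
have h2 : 2 * t ^+ 2 * q <= q ^+ 2 + t ^+ 4.
  by rewrite -subr_ge0 (_ : _ - _ = (q - t ^+ 2) ^+ 2) ?sqr_ge0 //; ring.
have := ler_wpM2l (mulr_ge0 (ler0n R 2) (exprn_ge0 2 t0)) hqt.
have -> : al + be = 2 * m by rewrite /m; field.
have -> : t ^+ 4 * (2 * m + 1) = 2 * t ^+ 2 * (t ^+ 2 * m) + t ^+ 4 by ring.
have -> : 2 * t ^+ 2 * (2 * t * k) = 4 * t ^+ 3 * k by ring.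
rewrite mulrDr; lra.
Qed.

End FiberCounting.

(** * Lower bound for the number of chains *)

(* [((v1, v2), (v0, v3))] encodes the chain v0, v1, v2, v3. *)
Definition chains {V Y1 Y2 Y3 : finType} (f1 : V -> Y1) (f2 : V -> Y2)
    (f3 : V -> Y3) : pred ((V * V) * (V * V)) :=
  fun q => (f2 q.1.1 == f2 q.1.2) &&
           ((f1 q.2.1 == f1 q.1.1) && (f3 q.2.2 == f3 q.1.2)).

(** Once v1 and v2 are fixed in a common fibre of [f2], v0 and v3 vary independently in the fibres
    of [f1] through v1 and of [f3] through v2. *)
Lemma card_chains {V Y1 Y2 Y3 : finType} (f1 : V -> Y1) (f2 : V -> Y2)
    (f3 : V -> Y3) :
  #|chains f1 f2 f3| =
  (\sum_(y : Y2) (\sum_(x | f2 x == y) #|[pred z | f1 z == f1 x]|) *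
                 (\sum_(x | f2 x == y) #|[pred z | f3 z == f3 x]|))%N.
Proof.
rewrite -sum1_card -(pair_big_dep (fun p : V * V => f2 p.1 == f2 p.2)
  (fun p r : V * V => (f1 r.1 == f1 p.1) && (f3 r.2 == f3 p.2))
  (fun _ _ => 1%N)) /=.
rewrite (partition_big (fun p : V * V => f2 p.1) predT) //=.
apply: eq_bigr => y _; rewrite big_distrlr /=.
rewrite (pair_big (fun x => f2 x == y) (fun x => f2 x == y)) /=.
apply: eq_big => [[x z] /=|[x z] _ /=].
  by rewrite andbC; case: eqP => //= ->; rewrite eq_sym.
rewrite -[RHS](cardX [pred u | f1 u == f1 x] [pred u | f3 u == f3 z]) -sum1_card.
by apply: eq_bigl => -[].
Qed.

Lemma expr4_card_le_chains {V Y1 Y2 Y3 : finType} (f1 : V -> Y1) (f2 : V -> Y2)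
    (f3 : V -> Y3) (M : nat) :
  (#|Y1| <= M)%N -> (#|Y2| <= M)%N -> (#|Y3| <= M)%N ->
  (#|V| ^ 4 <= M ^ 3 * #|chains f1 f2 f3|)%N.
Proof.
move=> h1 h2 h3; have [M0|M_gt0] := posnP M.
  case: (pickP V) => [x _|V0]; last by rewrite (eq_card0 V0).
  by move: h2; rewrite M0 leqn0 => /eqP/card0_eq/(_ (f2 x)).
pose d1 x : rat := #|[pred z | f1 z == f1 x]|%:R.
pose d3 x : rat := #|[pred z | f3 z == f3 x]|%:R.
have d1_gt0 x : 0 < d1 x.
  by rewrite ltr0n; apply/card_gt0P; exists x; rewrite inE.
have d3_gt0 x : 0 < d3 x.
  by rewrite ltr0n; apply/card_gt0P; exists x; rewrite inE.
(* With |V| = t M, the bounds [tangent_quartic] for the fibres of [f2] sum to 4 t^4 M <= |chains| +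
   3 t^4 M, since the terms [al], [be] and 1 each sum to at most M. *)
set t : rat := #|V|%:R / M%:R.
have t0 : 0 <= t by rewrite divr_ge0.
have /(ler_sum (index_enum Y2)) : forall y, true ->
    4 * t ^+ 3 * #|[pred x | f2 x == y]|%:R <=
    (\sum_(x | f2 x == y) d1 x) * (\sum_(x | f2 x == y) d3 x) +
    t ^+ 4 * (\sum_(x | f2 x == y) (d1 x)^-1 +
              \sum_(x | f2 x == y) (d3 x)^-1 + 1).
  move=> y _; apply: tangent_quartic => //; try (apply: sumr_ge0 => x _).
  - exact: ltW.
  - exact: ltW.
  - by rewrite invr_ge0 ltW.
  - by rewrite invr_ge0 ltW.
  - exact: (@sqr_card_le_sum_mul_sumV _ _ [pred x | f2 x == y]).
  - exact: (@sqr_card_le_sum_mul_sumV _ _ [pred x | f2 x == y]).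
rewrite big_split /= -!mulr_sumr !big_split /=.
have fibers (F : V -> rat) : \sum_y \sum_(x | f2 x == y) F x = \sum_x F x.
  by rewrite [RHS](partition_big f2 predT).
rewrite !fibers.
have -> : \sum_(y : Y2) #|[pred x | f2 x == y]|%:R = #|V|%:R :> rat.
  rewrite -sum1_card (partition_big f2 predT) //= natr_sum.
  by apply: eq_bigr => y _; rewrite sum1_card.
have -> : \sum_(y : Y2) (\sum_(x | f2 x == y) d1 x) *
    (\sum_(x | f2 x == y) d3 x) = #|chains f1 f2 f3|%:R.
  by rewrite card_chains natr_sum; apply: eq_bigr => y _;
     rewrite natrM !natr_sum.
rewrite sumr_const -/(#|Y2|%:R) => main.
have s1 : \sum_x (d1 x)^-1 <= M%:R.
  by apply: le_trans (sum_inv_card_fiber rat f1) _; rewrite ler_nat.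
have s3 : \sum_x (d3 x)^-1 <= M%:R.
  by apply: le_trans (sum_inv_card_fiber rat f3) _; rewrite ler_nat.
have s2 : #|Y2|%:R <= M%:R :> rat by rewrite ler_nat.
have Mr : 0 < M%:R :> rat by rewrite ltr0n.
have : 4 * t ^+ 3 * #|V|%:R <= #|chains f1 f2 f3|%:R + t ^+ 4 * (3 * M%:R).
  apply: le_trans main _; rewrite lerD2l ler_wpM2l ?exprn_ge0 //.
  by move: s1 s2 s3; set A := \sum_x _; set B := \sum_x _; lra.
have Vt : #|V|%:R = t * M%:R by rewrite /t divfK // gt_eqF.
rewrite -(ler_nat rat) natrM !natrX Vt => h.
have -> : (t * M%:R) ^+ 4 = M%:R ^+ 3 * (t ^+ 4 * M%:R) by ring.
rewrite ler_pM2l ?exprn_gt0 // -(lerD2r (t ^+ 4 * (3 * M%:R))).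
by apply: le_trans h; rewrite le_eqVlt; apply/orP; left; apply/eqP; ring.
Qed.

(** * The Katz-Tao sums-differences inequality *)

Section KatzTao.
Variables (U : zmodType) (T A B C : finType) (N : nat).
Variables (a : T -> A) (b : T -> B) (c : T -> C).
Variables (alpha : A -> U) (beta : B -> U) (gamma : C -> U).
Hypotheses (cardA : (#|A| <= N)%N) (cardB : (#|B| <= N)%N).
Hypothesis cardC : (#|C| <= N)%N.
Hypotheses (alpha_inj : injective alpha) (beta_inj : injective beta).
Hypothesis gammaE : forall t, gamma (c t) = alpha (a t) + beta (b t).
Hypothesis diff_inj : injective (fun t => alpha (a t) - beta (b t)).

(** The pair (t, t') stands for the triple (a, b, b') with a = a t = a t', b = b t and b' = b t'. *)
Let V := {x : T * T | a x.1 == a x.2}.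

Lemma ab_inj t t' : a t = a t' -> b t = b t' -> t = t'.
Proof. by move=> ea eb; apply: diff_inj; rewrite /= ea eb. Qed.

(** |V| is the sum over T of the size of the [a]-fibre of each element, and the inverses of these
    sizes sum to at most N. *)
Lemma sqr_card_le_V : (#|T| ^ 2 <= N * #|{: V}|)%N.
Proof.
have cV : #|{: V}| = (\sum_x #|[pred y | a y == a x]|)%N.
  rewrite card_sig -sum1_card.
  rewrite (eq_bigl (fun p : T * T => true && (a p.2 == a p.1))); last first.
    by move=> p /=; rewrite inE /= eq_sym.
  rewrite -(pair_big_dep predT (fun x y : T => a y == a x) (fun _ _ => 1%N)) /=.
  by apply: eq_bigr => x _; rewrite sum1_card.
have fib_gt0 (x : T) : 0 < #|[pred y | a y == a x]|%:R :> rat.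
  by rewrite ltr0n; apply/card_gt0P; exists x; rewrite inE.
have := @sqr_card_le_sum_mul_sumV _ T predT _ fib_gt0.
rewrite -natr_sum -cV -(ler_nat rat) natrM natrX mulrC => h.
apply: le_trans h _; apply: ler_wpM2r => //.
by apply: le_trans (sum_inv_card_fiber rat a) _; rewrite ler_nat.
Qed.

(* On a chain, a3 - b3' = a2 - b3 + (b0 - b0'). Hence v0, a2 and b3 determine a
   difference in T, thus the pair (a3, b3') itself, and then the whole chain. *)
Lemma card_V_chains :
  (#|chains (fun v : V => (c (val v).1, c (val v).2))
            (fun v : V => (b (val v).1, b (val v).2))
            (fun v : V => (c (val v).1, b (val v).2))| <= #|{: V}| * N ^ 2)%N.
Proof.
set Q := chains _ _ _.
pose key (q : (V * V) * (V * V)) : V * (A * B) :=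
  (q.2.1, (a (val q.1.2).1, b (val q.2.2).1)).
suff key_inj : {in Q &, injective key}.
  rewrite -(card_in_image key_inj); apply: leq_trans (max_card _) _.
  by rewrite !card_prod leq_mul2l -mulnn leq_mul ?orbT.
have V_eq (v v' : V) : a (val v).1 = a (val v').1 ->
    b (val v).1 = b (val v').1 -> b (val v).2 = b (val v').2 -> v = v'.
  case: v v' => [[t u] /= e] [[t' u'] /= e'] ea eb eb'.
  apply: val_inj => /=; congr pair; first exact: ab_inj.
  by apply: ab_inj; rewrite // -(eqP e) -(eqP e').
have aE (v : V) : a (val v).2 = a (val v).1 by rewrite (eqP (valP v)).
have facts q : q \in Q ->
  let: ((v1, v2), (v0, v3)) := q in
  [/\ alpha (a (val v3).2) - beta (b (val v3).2) =
      alpha (a (val v2).1) - beta (b (val v3).1) +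
      (beta (b (val v0).1) - beta (b (val v0).2)),
      b (val v3).2 = b (val v2).2, b (val v1).1 = b (val v2).1 /\
      b (val v1).2 = b (val v2).2,
      beta (b (val v1).1) = beta (b (val v1).2) +
      (beta (b (val v0).1) - beta (b (val v0).2)) &
      alpha (a (val v1).1) = alpha (a (val v0).1) + beta (b (val v0).1)
        - beta (b (val v1).1)].
  case: q => -[v1 v2] [v0 v3].
  rewrite unfold_in /Q /chains /=.
  move=> /and3P[/eqP[b12 b12'] /eqP[c01 c01'] /eqP[c32 b32]].
  have e1 := gammaE (val v0).1; have e2 := gammaE (val v0).2.
  have e3 := gammaE (val v3).1.
  rewrite c01 gammaE in e1; rewrite c01' gammaE !aE in e2.
  rewrite c32 gammaE in e3.
  (* v0 and v1 agree on a+b and on a+b'; subtracting the two sums eliminates a. *)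
  have d01 : beta (b (val v1).1) = beta (b (val v1).2) +
      (beta (b (val v0).1) - beta (b (val v0).2)).
    have cancel (x y z : U) : x + y - (x + z) = y - z.
      by rewrite opprD addrACA subrr add0r.
    have : alpha (a (val v1).1) + beta (b (val v1).1) -
      (alpha (a (val v1).1) + beta (b (val v1).2)) =
      alpha (a (val v0).1) + beta (b (val v0).1) -
      (alpha (a (val v0).1) + beta (b (val v0).2)) by rewrite e1 e2.
    by rewrite !cancel => <-; rewrite addrC subrK.
  split => //; last by rewrite -e1 addrK.
  rewrite aE b32 -b12'.
  have -> : alpha (a (val v3).1) =
      alpha (a (val v2).1) + beta (b (val v1).1) - beta (b (val v3).1).
    by rewrite b12 e3 addrK.
  have rearrange (x y z u : U) : z + (x + y) - u - x = z - u + y.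
    by rewrite [x + y]addrC addrA [LHS]addrAC addrK addrAC.
  by rewrite d01 rearrange.
move=> [[v1 v2] [v0 v3]] [[w1 w2] [w0 w3]] /facts fv /facts fw.
case: fv => dv b3v [b1v b1v'] bv av; case: fw => dw b3w [b1w b1w'] bw aw.
case=> e0 e2 e3; subst w0.
(* Order of recovery: the pair (a3, b3') from its difference; b1' = b2' = b3'; b1 = b2 from b1 - b1'
   = b0 - b0'; a1 from a1 + b1 = a0 + b0. The values a2 and b3 come from the key. *)
have e32 : (val v3).2 = (val w3).2 by apply: diff_inj; rewrite /= dv dw e2 e3.
have a3 : a (val v3).1 = a (val w3).1 by rewrite -!aE e32.
have b2' : b (val v2).2 = b (val w2).2 by rewrite -b3v -b3w e32.
have b1' : b (val v1).2 = b (val w1).2 by rewrite b1v' b1w'.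
have b1 : b (val v1).1 = b (val w1).1 by apply: beta_inj; rewrite bv bw b1'.
have a1 : a (val v1).1 = a (val w1).1 by apply: alpha_inj; rewrite av aw b1.
by congr (_, _, (_, _)); apply: V_eq => //; rewrite -?b1v -?b1w // e32.
Qed.

Lemma katz_tao : (#|T| ^ 6 <= N ^ 11)%N.
Proof.
have cXX (X Y : finType) :
    (#|X| <= N -> #|Y| <= N -> #|{: X * Y}| <= N ^ 2)%N.
  by move=> hX hY; rewrite card_prod -mulnn leq_mul.
(* Each link compares a pair of values, hence the bound N^2 for each codomain. *)
have h := @expr4_card_le_chains _ _ _ _ (fun v : V => (c (val v).1, c (val v).2))
            (fun v : V => (b (val v).1, b (val v).2))
            (fun v : V => (c (val v).1, b (val v).2)) (N ^ 2)
            (cXX _ _ cardC cardC) (cXX _ _ cardB cardB) (cXX _ _ cardC cardB).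
have {}h := leq_trans h (leq_mul (leqnn _) card_V_chains).
have h2 := sqr_card_le_V.
have hV : (#|{: V}| ^ 3 <= N ^ 8)%N.
  have [->|V_gt0] := posnP #|{: V}|; first by rewrite exp0n.
  rewrite -(leq_pmul2l V_gt0) -expnS; apply: leq_trans h _.
  by rewrite -expnM mulnCA -expnD.
rewrite (expnM _ 2 3); apply: (@leq_trans ((N * #|{: V}|) ^ 3)).
  by rewrite leq_exp2r.
by rewrite expnMn (expnD N 3 8) leq_mul2l hV orbT.
Qed.

End KatzTao.

(** * Abelian squares as progressions of prefix vectors *)

Section PrefixParikh.
Variable sigma : nat.
Implicit Types s w : seq 'I_sigma.

(** Integer entries make differences of Parikh vectors available in a group. *)
Definition parikhz s : {ffun 'I_sigma -> int} := [ffun c => (count_mem c s)%:Z].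

Lemma parikhz_cat s1 s2 : parikhz (s1 ++ s2) = parikhz s1 + parikhz s2.
Proof. by apply/ffunP => c; rewrite !ffunE count_cat PoszD. Qed.

Lemma parikhzP s1 s2 : parikh s1 = parikh s2 <-> parikhz s1 = parikhz s2.
Proof.
split=> /ffunP h; apply/ffunP => c; move: (h c); rewrite !ffunE;
  by [move=> -> | case].
Qed.

Lemma sum_parikhz s : \sum_c parikhz s c = (size s)%:Z.
Proof.
elim: s => [|x s IH]; first by apply: big1 => c _; rewrite ffunE.
rewrite -cat1s parikhz_cat size_cat PoszD -IH.
under eq_bigr do rewrite ffunE.
rewrite big_split /= (bigD1 x) //= big1 ?addr0 ?ffunE /= ?eqxx //.
by move=> c ne; rewrite ffunE /= eq_sym (negPf ne).
Qed.

(** The entries of a prefix vector sum to the length of the prefix. *)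
Lemma prefix_parikhz_inj w i j : (i <= size w)%N -> (j <= size w)%N ->
  parikhz (take i w) = parikhz (take j w) -> i = j.
Proof.
move=> hi hj e.
have : \sum_c parikhz (take i w) c = \sum_c parikhz (take j w) c by rewrite e.
by rewrite !sum_parikhz !size_takel // => -[].
Qed.

Lemma abelian_square_factor_prefixes s w : infix s w -> abelian_square s ->
  exists i k, [/\ (0 < k)%N, (i + k + k <= size w)%N,
    parikhz (take (i + k + k) w) - parikhz (take i w) = parikhz s &
    parikhz (take (i + k) w) + parikhz (take (i + k) w) =
      parikhz (take i w) + parikhz (take (i + k + k) w)].
Proof.
move=> /infixP[p [q ->]] /abelian_squareP[u [v [-> [u0 _] suv /parikhzP puv]]].
have E0 : take (size p) (p ++ (u ++ v) ++ q) = p by rewrite take_size_cat.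
have E1 : take (size p + size u) (p ++ (u ++ v) ++ q) = p ++ u.
  by rewrite -catA (catA p) take_size_cat ?size_cat.
have E2 : take (size p + size u + size u) (p ++ (u ++ v) ++ q) = p ++ u ++ v.
  by rewrite catA take_size_cat // !size_cat suv addnA.
exists (size p), (size u); rewrite E0 E1 E2; split.
- by case: u u0 {suv puv E0 E1 E2}.
- by rewrite !size_cat suv -addnA leq_add2l leq_addr.
- by rewrite [parikhz (p ++ _)]parikhz_cat addrC addKr.
- by rewrite !parikhz_cat puv -!addrA; congr (_ + _); rewrite addrCA.
Qed.

Lemma num_nonequiv_abelian_squares_pow6 n (w : n.-tuple 'I_sigma) :
  (num_nonequiv_abelian_squares w ^ 6 <= n.-1 ^ 11)%N.
Proof.
rewrite /num_nonequiv_abelian_squares; set cls := equivalence_partition _ _.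
pose T : finType := {X : {set n.-bseq 'I_sigma} | X \in cls}.
pose N := n.-1.
(* As k >= 1, the first, last and middle positions lie in 0..n-2, 2..n and 1..n-1; the shifts 0, 2
   and 1 index each range by ['I_N]. Doubling the middle vector in [gamma] makes it the sum of the
   outer two. *)
pose alpha (i : 'I_N) := parikhz (take i w).
pose beta (i : 'I_N) := parikhz (take i.+2 w).
pose gamma (i : 'I_N) := parikhz (take i.+1 w) + parikhz (take i.+1 w).
have ex (t : T) : exists x : ('I_N * 'I_N * 'I_N) * n.-bseq 'I_sigma,
    [/\ beta x.1.1.2 - alpha x.1.1.1 = parikhz x.2,
        gamma x.1.2 = alpha x.1.1.1 + beta x.1.1.2 &
        val t = [set y in abelian_square_factors w | abelian_equiv x.2 y]].
  case: t => X /= /imsetP[s]; rewrite inE => /andP[inf sq] ->.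
  have [i [k [k0 hk e1 e2]]] := abelian_square_factor_prefixes inf sq.
  rewrite size_tuple in hk.
  have hi : (i < N)%N by rewrite /N; lia.
  have hj : ((i + k + k).-2 < N)%N by rewrite /N; lia.
  have hm : ((i + k).-1 < N)%N by rewrite /N; lia.
  exists ((Ordinal hi, Ordinal hj, Ordinal hm), s); rewrite /alpha /beta /gamma /=.
  have -> : (i + k + k).-2.+2 = (i + k + k)%N by lia.
  have -> : (i + k).-1.+1 = (i + k)%N by lia.
  by split.
(* Choose one representative square, with its positions, for each class. *)
have [x hx] := fin_all_exists ex.
have in_w (i : 'I_N) : (i.+2 <= size w)%N.
  by rewrite size_tuple; have := ltn_ord i; rewrite /N; lia.
rewrite -card_sig -/N.
apply: (@katz_tao _ T 'I_N 'I_N 'I_N N (fun t => (x t).1.1.1)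
  (fun t => (x t).1.1.2) (fun t => (x t).1.2) alpha beta gamma);
  rewrite ?card_ord //.
- move=> i j /prefix_parikhz_inj e; apply: val_inj.
  by apply: e; do 2![apply: ltnW]; exact: in_w.
- by move=> i j /prefix_parikhz_inj -/(_ (in_w i) (in_w j))[]/val_inj.
- by move=> t; case: (hx t).
(* The difference alpha - beta is the negated Parikh vector of the representative, which determines
   the class. *)
- move=> t t' /(congr1 -%R); rewrite !opprB.
  case: (hx t) => -> _ Et; case: (hx t') => -> _ Et' /parikhzP e.
  by apply: val_inj; rewrite Et Et'; apply/setP => y; rewrite !inE /abelian_equiv e.
Qed.

End PrefixParikh.

(** * Passage to the maximum and to real exponents *)

Lemma SQ'_Abel_pow6 n sigma : (SQ'_Abel n sigma ^ 6 <= n.-1 ^ 11)%N.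
Proof.
rewrite /SQ'_Abel; elim/big_ind: _ => [|p q hp hq|w _] //.
- by case: (leqP p q).
- exact: num_nonequiv_abelian_squares_pow6.
Qed.

Theorem theorem11 (R : realType) (sigma n : nat)
    (hsigma : (1 <= sigma)%N) (hn : (1 <= n)%N) :
  (SQ'_Abel n sigma)%:R <= ((n%:R - 1) `^ (11%:R / 6%:R) : R).
Proof.
have -> : n%:R - 1 = n.-1%:R :> R by rewrite -[in LHS](prednK hn) -natr1 addrK.
have := SQ'_Abel_pow6 n sigma; rewrite -(ler_nat R) !natrX => h.
(* Sixth powers of nonnegative reals are compared, turning the exponent 11/6 into 11. *)
have : (SQ'_Abel n sigma)%:R `^ 6%:R <= (n.-1%:R `^ (11%:R / 6%:R)) `^ 6%:R :> R.
  by rewrite -powRrM divfK ?pnatr_eq0 // !powR_mulrn.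
by rewrite !powR_mulrn ?powR_ge0 // ler_pXn2r // ?nnegrE ?powR_ge0.
Qed.
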